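(* Let $(X,d)$ be a discrete metric space and let $A$ be a point amenable Banach algebra. Then for every $x\in X$ and $\varphi\in\Delta(A)$, every continuous point derivation of $\mathrm{Lip}(X,A)$ at $x\otimes\varphi$ is zero.
   Context: For a metric space $(X,d)$ and a Banach algebra $(A,\|\cdot\|)$, $\mathrm{Lip}(X,A)$ is the set of bounded functions $f:X\to A$ with $p_{d,A}(f)=\sup_{x\ne y}\|f(x)-f(y)\|/d(x,y)<\infty$. It is a Banach algebra under pointwise multiplication and the norm $\|f\|_{d,A}=\|f\|_{\infty,A}+p_{d,A}(f)$, where $\|f\|_{\infty,A}=\sup_{x\in X}\|f(x)\|$. $X$ is discrete if every singleton is open. For a Banach algebra $B$, $\Delta(B)$ is its character space (nonzero multiplicative linear functionals $B\to\mathbb{C}$). A continuous point derivation of $B$ at $\psi\in\Delta(B)$ is a continuous linear functional $D:B\to\mathbb{C}$ with $D(ab)=\psi(a)D(b)+\psi(b)D(a)$ for all $a,b\in B$. $B$ is point amenable if for every $\psi\in\Delta(B)$ the only continuous point derivation at $\psi$ is zero. For $x\in X$, $\varphi\in\Delta(A)$, $x\otimes\varphi$ is the character of $\mathrm{Lip}(X,A)$ given by $f\mapsto\varphi(f(x))$. *)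

(* Defs.v *)
From HB Require Import structures.
From mathcomp Require Import all_boot all_order all_algebra complex.
From mathcomp Require Import all_classical all_reals all_analysis.

Set Implicit Arguments.
Unset Strict Implicit.
Unset Printing Implicit Defensive.

Import Order.TTheory GRing.Theory Num.Theory.
Import numFieldNormedType.Exports.

Local Open Scope classical_set_scope.
Local Open Scope ring_scope.

(* The product [bmul] is separate from the ring structures of MathComp, which
   are unital: Banach algebras are neither assumed unital nor commutative. *)
HB.mixin Record isBanachAlgebra (K : numFieldType) A
    & CompleteNormedModule K A := {
  bmul : A -> A -> A ;
  bmulA : associative bmul ;
  bmulDl : left_distributive bmul +%R ;
  bmulDr : right_distributive bmul +%R ;
  bmulZl : forall (k : K) (a b : A), bmul (k *: a) b = k *: bmul a b ;
  bmulZr : forall (k : K) (a b : A), bmul a (k *: b) = k *: bmul a b ;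
  norm_bmul : forall a b : A, `|bmul a b| <= `|a| * `|b| }.

#[short(type="banachAlgType")]
HB.structure Definition BanachAlgebra (K : numFieldType) :=
  {A of CompleteNormedModule K A & isBanachAlgebra K A}.

Section point_derivations.
Context {R : realType} (B : banachAlgType R[i]).

Record character := Character {
  character_fun :> {scalar B} ;
  characterM : forall a b : B,
    character_fun (bmul a b) = character_fun a * character_fun b ;
  character_neq0 : exists a : B, character_fun a != 0 }.

Definition continuous_point_derivation (psi : character) (D : {scalar B}) :=
  continuous (D : B -> R[i]^o) /\
  forall a b : B, D (bmul a b) = psi a * D b + psi b * D a.

Definition point_amenable :=
  forall (psi : character) (D : {scalar B}),
    continuous_point_derivation psi D -> forall b : B, D b = 0.

End point_derivations.

(* The norm of a normed space over [R[i]] takes its values in [R[i]]; [rnorm]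
   is the same norm, seen in [R]. *)
Section real_norm.
Context {R : realType} {V : normedModType R[i]}.
Implicit Types u v : V.

Definition rnorm v : R := complex.Re `|v|.

Lemma rnormE v : `|v| = (rnorm v)%:C%C.
Proof.
rewrite /rnorm; have := normr_ge0 v; case: `|v| => a b.
by rewrite lecE/= => /andP[/eqP -> _].
Qed.

Lemma rnorm_ge0 v : 0 <= rnorm v.
Proof. by have := normr_ge0 v; rewrite rnormE lecR. Qed.

Lemma rnorm0 : rnorm (0 : V) = 0.
Proof. by rewrite /rnorm normr0. Qed.

Lemma rnorm_eq0 v : rnorm v = 0 -> v = 0.
Proof. by move=> v0; apply/eqP; rewrite -normr_eq0 rnormE v0. Qed.

Lemma rnormD u v : rnorm (u + v) <= rnorm u + rnorm v.
Proof. by have := ler_normD u v; rewrite !rnormE -rmorphD lecR. Qed.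

Lemma rnormN v : rnorm (- v) = rnorm v.
Proof. by rewrite /rnorm normrN. Qed.

Lemma rnormZ (k : R[i]) v : rnorm (k *: v) = complex.Re `|k| * rnorm v.
Proof.
apply: complexI; rewrite rmorphM/= -!rnormE normrZ; congr (_ * _).
Qed.

End real_norm.

Section lipschitz_functions.
Context {R : realType} {X : metricType R} {A : banachAlgType R[i]}.
Implicit Types f g : X -> A.

(* [sup set0 = 0], so both suprema below vanish when they range over nothing. *)
Definition sup_norm f : R := sup [set rnorm (f x) | x in [set: X]].

Definition difference_quotients f : set R :=
  [set r | exists x y, x != y /\ r = rnorm (f x - f y) / mdist x y].

Definition lip_seminorm f : R := sup (difference_quotients f).

Definition is_lip f : Prop :=
  has_ubound [set rnorm (f x) | x in [set: X]] /\
  has_ubound (difference_quotients f).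

Lemma is_lipP f : is_lip f <->
  exists2 M : R, forall x, rnorm (f x) <= M &
    forall x y, rnorm (f x - f y) <= M * mdist x y.
Proof.
split=> [[[M1 fM1] [M2 fM2]]|[M fM fdM]].
  exists (Num.max M1 M2) => [x|x y].
    by rewrite le_max fM1//=; exists x.
  have [->|xy] := eqVneq x y; first by rewrite subrr rnorm0 mdistxx mulr0.
  rewrite -ler_pdivrMr ?mdist_gt0// le_max; apply/orP; right; apply: fM2.
  by exists x, y.
split; exists M; first by move=> _ [x _ <-].
by move=> _ [x [y [xy ->]]]; rewrite ler_pdivrMr ?mdist_gt0.
Qed.

Lemma sup_norm_le f (M : R) : 0 <= M -> (forall x, rnorm (f x) <= M) ->
  sup_norm f <= M.
Proof.
move=> M0 fM; rewrite /sup_norm; set S := [set _ | _ in _].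
have [->|S0] := eqVneq S set0; first by rewrite sup0.
by apply: ge_sup; [exact/set0P|move=> _ [x _ <-]].
Qed.

Lemma lip_seminorm_le f (M : R) : 0 <= M ->
  (forall x y, rnorm (f x - f y) <= M * mdist x y) -> lip_seminorm f <= M.
Proof.
move=> M0 fM; rewrite /lip_seminorm.
have [->|S0] := eqVneq (difference_quotients f) set0; first by rewrite sup0.
apply: ge_sup; first exact/set0P.
by move=> _ [x [y [xy ->]]]; rewrite ler_pdivrMr ?mdist_gt0.
Qed.

Lemma sup_norm_ge f x : is_lip f -> rnorm (f x) <= sup_norm f.
Proof. by case=> fb _; apply: ub_le_sup => //; exists x. Qed.

Lemma lip_seminorm_ge f x y : is_lip f ->
  rnorm (f x - f y) <= lip_seminorm f * mdist x y.
Proof.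
case=> _ fb; have [->|xy] := eqVneq x y.
  by rewrite subrr rnorm0 mdistxx mulr0.
by rewrite -ler_pdivrMr ?mdist_gt0//; apply: ub_le_sup => //; exists x, y.
Qed.

Lemma sup_norm_ge0 f : is_lip f -> 0 <= sup_norm f.
Proof.
move=> fL; have [[x _]|/set0P/negP/negPn/eqP X0] := pselect ([set: X] !=set0).
  exact: le_trans (rnorm_ge0 _) (sup_norm_ge x fL).
by rewrite /sup_norm X0 image_set0 sup0.
Qed.

Lemma lip_seminorm_ge0 f : is_lip f -> 0 <= lip_seminorm f.
Proof.
move=> fL; rewrite /lip_seminorm.
have [->|/set0P[_ [x [y [xy _]]]]] := eqVneq (difference_quotients f) set0.
  by rewrite sup0.
rewrite -(@pmulr_lge0 _ (mdist x y)) ?mdist_gt0//.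
exact: le_trans (rnorm_ge0 _) (lip_seminorm_ge x y fL).
Qed.

Lemma lip_seminormD f g : is_lip f -> is_lip g ->
  lip_seminorm (f + g) <= lip_seminorm f + lip_seminorm g.
Proof.
move=> fL gL; apply: lip_seminorm_le => [|x y].
  by rewrite addr_ge0// lip_seminorm_ge0.
rewrite !fctE opprD addrACA mulrDl (le_trans (rnormD _ _))//.
by rewrite lerD// lip_seminorm_ge.
Qed.

Lemma sup_normD f g : is_lip f -> is_lip g ->
  sup_norm (f + g) <= sup_norm f + sup_norm g.
Proof.
move=> fL gL; apply: sup_norm_le => [|x].
  by rewrite addr_ge0// sup_norm_ge0.
by rewrite (le_trans (rnormD _ _))// lerD// sup_norm_ge.
Qed.

Lemma is_lip_cst (a : A) : is_lip (cst a).
Proof.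
apply/is_lipP; exists (rnorm a) => // x y.
by rewrite subrr rnorm0 mulr_ge0 ?rnorm_ge0// mdist_ge0.
Qed.

Lemma is_lipD f g : is_lip f -> is_lip g -> is_lip (f + g).
Proof.
move=> /is_lipP[M fM fdM] /is_lipP[N gN gdN]; apply/is_lipP.
exists (M + N) => [x|x y]; first by rewrite (le_trans (rnormD _ _))// lerD.
by rewrite !fctE opprD addrACA mulrDl (le_trans (rnormD _ _))// lerD.
Qed.

Lemma is_lipZ (k : R[i]) f : is_lip f -> is_lip (k *: f).
Proof.
move=> /is_lipP[M fM fdM]; apply/is_lipP.
have k0 : 0 <= complex.Re `|k| := @rnorm_ge0 R R[i]^o k.
exists (complex.Re `|k| * M) => [x|x y]; first by rewrite rnormZ ler_wpM2l.
by rewrite -scalerBr rnormZ -mulrA ler_wpM2l.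
Qed.

Lemma rnorm_bmul (a b : A) : rnorm (bmul a b) <= rnorm a * rnorm b.
Proof. by have := norm_bmul a b; rewrite !rnormE -rmorphM lecR. Qed.

Lemma bmul_subE (a b c d : A) :
  bmul a b - bmul c d = bmul a (b - d) + bmul (a - c) d.
Proof.
rewrite bmulDr bmulDl -(scaleN1r d) -(scaleN1r c) bmulZl bmulZr !scaleN1r.
by rewrite addrA subrK.
Qed.

Lemma is_lipM f g : is_lip f -> is_lip g -> is_lip (fun x => bmul (f x) (g x)).
Proof.
move=> /is_lipP[M fM fdM] /is_lipP[N gN gdN]; apply/is_lipP.
exists (M * N + M * N) => [x|x y].
  have MN : rnorm (bmul (f x) (g x)) <= M * N.
    by rewrite (le_trans (rnorm_bmul _ _))// ler_pM ?rnorm_ge0.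
  by rewrite (le_trans MN)// lerDl (le_trans _ MN)// rnorm_ge0.
rewrite bmul_subE (le_trans (rnormD _ _))// mulrDl lerD//.
  by rewrite (le_trans (rnorm_bmul _ _))// -mulrA ler_pM ?rnorm_ge0.
by rewrite (le_trans (rnorm_bmul _ _))// mulrAC ler_pM ?rnorm_ge0.
Qed.

End lipschitz_functions.

Section lip_type.
Context {R : realType} (X : metricType R) (A : banachAlgType R[i]).

Definition lip_pred : {pred X -> A} := fun f => `[< is_lip f >].

Record Lip := MkLip { lip_fun :> X -> A ; lip_funP : lip_fun \in lip_pred }.

HB.instance Definition _ := [isSub for lip_fun].
HB.instance Definition _ := [Choice of Lip by <:].

Lemma lip_submod_closed : submod_closed lip_pred.
Proof.
split; first by apply/asboolP; exact: is_lip_cst.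
move=> k f g /asboolP fL /asboolP gL; apply/asboolP.
by apply: is_lipD => //; exact: is_lipZ.
Qed.

HB.instance Definition _ := GRing.isSubmodClosed.Build R[i] (X -> A) lip_pred
  lip_submod_closed.
HB.instance Definition _ := [SubChoice_isSubLmodule of Lip by <:].

Lemma Lip_lip (f : Lip) : is_lip f.
Proof. exact/asboolP/(lip_funP f). Qed.

Lemma Lip_ext (f g : Lip) : (forall x, f x = g x) -> f = g.
Proof. by move=> fg; apply/val_inj/funext. Qed.

End lip_type.

Section lip_normed.
Context {R : realType} (X : metricType R) (A : banachAlgType R[i]).
Implicit Types f g h : Lip X A.

Definition lip_norm f : R := sup_norm f + lip_seminorm f.

Lemma lip_norm_ge0 f : 0 <= lip_norm f.
Proof. by rewrite addr_ge0 ?sup_norm_ge0 ?lip_seminorm_ge0//; exact: Lip_lip. Qed.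

Lemma lip_normD f g : lip_norm (f + g) <= lip_norm f + lip_norm g.
Proof.
rewrite /lip_norm addrACA.
by rewrite lerD ?sup_normD ?lip_seminormD//; exact: Lip_lip.
Qed.

Lemma lip_norm_eq0 f : lip_norm f = 0 -> f = 0.
Proof.
move=> /eqP; rewrite paddr_eq0; last 2 first.
- by rewrite sup_norm_ge0//; exact: Lip_lip.
- by rewrite lip_seminorm_ge0//; exact: Lip_lip.
move=> /andP[/eqP f0 _]; apply: Lip_ext => x; apply: rnorm_eq0; apply/eqP.
by rewrite eq_le rnorm_ge0 andbT -f0 sup_norm_ge//; exact: Lip_lip.
Qed.

Lemma lip_normZ_le (k : R[i]) f :
  lip_norm (k *: f) <= complex.Re `|k| * lip_norm f.
Proof.
have k0 : 0 <= complex.Re `|k| := @rnorm_ge0 R R[i]^o k.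
have fL := Lip_lip f; rewrite mulrDr lerD//.
  apply: sup_norm_le => [|x]; first by rewrite mulr_ge0// sup_norm_ge0.
  by rewrite rnormZ ler_wpM2l// sup_norm_ge.
apply: lip_seminorm_le => [|x y]; first by rewrite mulr_ge0// lip_seminorm_ge0.
by rewrite -scalerBr rnormZ -mulrA ler_wpM2l// lip_seminorm_ge.
Qed.

Lemma lip_normZ (k : R[i]) f :
  (lip_norm (k *: f))%:C%C = `|k| * (lip_norm f)%:C%C.
Proof.
have normkE (z : R[i]) : `|z| = (complex.Re `|z|)%:C%C.
  exact: (@rnormE R R[i]^o z).
suff -> : lip_norm (k *: f) = complex.Re `|k| * lip_norm f.
  by rewrite [X in _ = X * _]normkE -rmorphM.
apply/eqP; rewrite eq_le lip_normZ_le andTb.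
have [->|k0] := eqVneq k 0; first by rewrite normr0 mul0r lip_norm_ge0.
have kgt0 : 0 < complex.Re `|k| by rewrite -ltcR -normkE normr_gt0.
have := lip_normZ_le k^-1 (k *: f); rewrite scalerA mulVf// scale1r.
suff -> : complex.Re `|k^-1| = (complex.Re `|k|)^-1 by rewrite ler_pdivlMl.
by apply: complexI; rewrite fmorphV -!normkE normfV.
Qed.

Let lip_normCD f g :
  (lip_norm (f + g))%:C%C <= (lip_norm f)%:C%C + (lip_norm g)%:C%C.
Proof. by rewrite -rmorphD lecR lip_normD. Qed.

Let lip_normC_eq0 f : (lip_norm f)%:C%C = 0 -> f = 0.
Proof. by move=> /(@complexI R _ 0) /lip_norm_eq0. Qed.

HB.instance Definition _ := Lmodule_isNormed.Build R[i] (Lip X A)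
  lip_normCD lip_normZ lip_normC_eq0.

Lemma Lip_normE f : `|f| = (lip_norm f)%:C%C. Proof. by []. Qed.

Lemma rnorm_lip_norm f x : rnorm (f x) <= lip_norm f.
Proof.
have fL := Lip_lip f.
by rewrite (le_trans (sup_norm_ge x fL))// lerDl lip_seminorm_ge0.
Qed.

Lemma lip_norm_dist f x y : rnorm (f x - f y) <= lip_norm f * mdist x y.
Proof.
have fL := Lip_lip f; rewrite (le_trans (lip_seminorm_ge x y fL))//.
by rewrite ler_wpM2r ?mdist_ge0// lerDr sup_norm_ge0.
Qed.

Lemma norm_Lip_eval f x : `|f x| <= `|f|.
Proof. by rewrite Lip_normE rnormE lecR rnorm_lip_norm. Qed.

Let Lip_complete (F : set_system (Lip X A)) :
  ProperFilter F -> cauchy F -> cvg F.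
Proof.
move=> FF /(@cauchyP R[i] (Lip X A) F FF) Fc.
have evalc x : cvg ((fun f : Lip X A => f x) @ F).
  apply/cauchy_cvgP/cauchy_exP => e e0; have [f Ff] := Fc e e0.
  exists (f x); rewrite /fmap/=; apply: filterS Ff => h.
  rewrite -!ball_normE/= => fh.
  by rewrite (le_lt_trans (norm_Lip_eval (f - h) x)).
pose g x := lim ((fun f : Lip X A => f x) @ F).
have near_g x (e : R) : 0 < e -> F [set h : Lip X A | rnorm (h x - g x) < e].
  move=> e0; have e0C : 0 < e%:C%C by rewrite (ltcR 0 e).
  have /cvgr_dist_lt/(_ _ e0C) := evalc x; apply: filterS => h.
  by rewrite distrC rnormE ltcR.
have approx f (r : R) : F (ball f r%:C%C) ->
    (forall x, rnorm (f x - g x) <= r) /\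
    (forall x y, rnorm ((f x - g x) - (f y - g y)) <= r * mdist x y).
  move=> Ff; split=> [x|x y]; apply/ler_addgt0Pr => e e0.
    have [h []] := filter_ex (filterI Ff (near_g x e e0)).
    rewrite -ball_normE/= Lip_normE ltcR => fh hg.
    have -> : f x - g x = (f x - h x) + (h x - g x) by rewrite addrA subrK.
    rewrite (le_trans (rnormD _ _))// lerD// ?(ltW hg)//.
    exact: le_trans (rnorm_lip_norm (f - h) x) (ltW fh).
  have e20 : 0 < e / 2 by rewrite divr_gt0.
  have [h [[]]] :=
    filter_ex (filterI (filterI Ff (near_g x _ e20)) (near_g y _ e20)).
  rewrite -ball_normE/= Lip_normE ltcR => fh hgx hgy.
  have -> : (f x - g x) - (f y - g y) =
      ((f - h) x - (f - h) y) + ((h x - g x) - (h y - g y)).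
    have E u : (f - h) u + (h u - g u) = f u - g u by rewrite addrA subrK.
    by rewrite addrACA -opprD !E.
  rewrite (le_trans (rnormD _ _))// lerD//.
    rewrite (le_trans (lip_norm_dist (f - h) x y))// ler_wpM2r ?mdist_ge0//.
    exact: ltW.
  rewrite (le_trans (rnormD _ _))// rnormN (splitr e) lerD//; exact: ltW.
have gL : is_lip g.
  have [f Ff] := Fc 1 ltr01.
  have [fg dfg] := @approx f 1 Ff.
  have -> : g = (f : X -> A) + (-1) *: (fun x => f x - g x).
    by apply/funext => x; rewrite !fctE scaleN1r opprB addrC subrK.
  apply: is_lipD; first exact: Lip_lip.
  by apply: is_lipZ; apply/is_lipP; exists 1.
have gLp : g \in @lip_pred R X A by exact/asboolP.
pose G := MkLip gLp.
apply/cvg_ex; exists G; apply/cvgrPdist_le => e e0.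
have eE : e = (complex.Re e)%:C%C.
  by move: e0; case: (e) => a b; rewrite ltcE/= => /andP[/eqP ->].
set r := complex.Re e / 3.
have r0 : 0 < r by rewrite divr_gt0// -ltcR -eE.
have r0C : 0 < r%:C%C by rewrite (ltcR 0 r).
have [f Ff] := Fc _ r0C; have [fg dfg] := approx f r Ff.
apply: filterS Ff => h; rewrite -ball_normE/= Lip_normE ltcR => fh.
rewrite (le_trans (ler_distD f _ _))// eE !Lip_normE -rmorphD/= lecR.
have -> : complex.Re e = (r + r) + r by rewrite -mulr2n -mulrSr -mulr_natr divfK.
rewrite lerD//; last exact: ltW.
have -> : lip_norm (G - f) = lip_norm (f - G).
  by apply: complexI; rewrite -!Lip_normE distrC.
by rewrite lerD//; [exact: sup_norm_le (ltW r0) _|exact: lip_seminorm_le (ltW r0) _].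
Qed.

HB.instance Definition _ := Uniform_isComplete.Build (Lip X A) Lip_complete.

Definition lip_mul f g : Lip X A :=
  MkLip (introT (asboolP _) (is_lipM (Lip_lip f) (Lip_lip g))).

Let lip_mulA : associative lip_mul.
Proof. by move=> f g h; apply: Lip_ext => x; exact: bmulA. Qed.

Let lip_mulDl : left_distributive lip_mul +%R.
Proof. by move=> f g h; apply: Lip_ext => x; exact: bmulDl. Qed.

Let lip_mulDr : right_distributive lip_mul +%R.
Proof. by move=> f g h; apply: Lip_ext => x; exact: bmulDr. Qed.

Let lip_mulZl (k : R[i]) f g : lip_mul (k *: f) g = k *: lip_mul f g.
Proof. by apply: Lip_ext => x; exact: bmulZl. Qed.

Let lip_mulZr (k : R[i]) f g : lip_mul f (k *: g) = k *: lip_mul f g.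
Proof. by apply: Lip_ext => x; exact: bmulZr. Qed.

Let norm_lip_mul f g : `|lip_mul f g| <= `|f| * `|g|.
Proof.
have [fL gL] := (Lip_lip f, Lip_lip g).
rewrite !Lip_normE -rmorphM/= lecR.
have [f0 g0] := (sup_norm_ge0 fL, sup_norm_ge0 gL).
have [pf0 pg0] := (lip_seminorm_ge0 fL, lip_seminorm_ge0 gL).
apply: (@le_trans _ _ (sup_norm f * sup_norm g +
    (sup_norm f * lip_seminorm g + lip_seminorm f * sup_norm g))).
  apply: lerD.
    apply: sup_norm_le => [|x]; first exact: mulr_ge0.
    rewrite (le_trans (rnorm_bmul _ _))//.
    by rewrite ler_pM ?rnorm_ge0// sup_norm_ge.
  apply: lip_seminorm_le => [|x y]; first by rewrite addr_ge0// mulr_ge0.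
  rewrite /= bmul_subE (le_trans (rnormD _ _))// mulrDl lerD//.
    rewrite (le_trans (rnorm_bmul _ _))// -mulrA.
    by rewrite ler_pM ?rnorm_ge0// ?sup_norm_ge// lip_seminorm_ge.
  rewrite (le_trans (rnorm_bmul _ _))// mulrAC.
  by rewrite ler_pM ?rnorm_ge0// ?sup_norm_ge// lip_seminorm_ge.
rewrite /lip_norm mulrDl !mulrDr -!addrA !lerD//.
by rewrite lerDl mulr_ge0.
Qed.

HB.instance Definition _ := isBanachAlgebra.Build R[i] (Lip X A)
  lip_mulA lip_mulDl lip_mulDr lip_mulZl lip_mulZr norm_lip_mul.

End lip_normed.

Section evaluation_characters.
Context {R : realType} (X : metricType R) (A : banachAlgType R[i]).
Variables (x : X) (phi : character A).

Definition eval_fun (f : Lip X A) : R[i]^o := phi (f x).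

Let eval_fun_is_scalar : scalar eval_fun.
Proof. by move=> k f g; rewrite /eval_fun linearP. Qed.

HB.instance Definition _ :=
  GRing.isLinear.Build R[i] (Lip X A) R[i]^o *%R eval_fun eval_fun_is_scalar.

Let eval_funM (f g : Lip X A) :
  eval_fun (bmul f g) = eval_fun f * eval_fun g.
Proof. exact: characterM. Qed.

Let eval_fun_neq0 : exists f : Lip X A, eval_fun f != 0.
Proof.
have [a phia] := character_neq0 phi.
by exists (MkLip (introT (asboolP _) (is_lip_cst a))).
Qed.

(* The character written x ⊗ phi. *)
Definition eval_character : character (Lip X A) :=
  @Character R (Lip X A) eval_fun eval_funM eval_fun_neq0.

End evaluation_characters.

(* Main.v *)
Require Import Defs.
From HB Require Import structures.
From mathcomp Require Import all_boot all_order all_algebra complex.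
From mathcomp Require Import all_classical all_reals all_analysis.
Import numFieldNormedType.Exports.
Local Open Scope classical_set_scope.
Local Open Scope ring_scope.

(** Since [x] is isolated, for every [a] in [A] the function [point_mass a],
    with value [a] at [x] and [0] elsewhere, is Lipschitz, with a Lipschitz norm
    at most a constant times the norm of [a] ([lip_norm_point_mass]). Hence
    [a |-> point_mass a] is a continuous linear map from [A] to [Lip X A]; it is
    multiplicative and a section of the evaluation at [x]. Composing [D] with it
    gives a continuous point derivation of [A] at [phi], which vanishes because
    [A] is point amenable: [D] kills every point mass at [x]. Take [a] with
    [phi a != 0]. For any [f], the product of [point_mass a] and [f] is again a
    point mass, so the Leibniz rule reads
    [0 = phi a * D f + phi (f x) * D (point_mass a) = phi a * D f], whence
    [D f = 0]. *)

Import Order.TTheory GRing.Theory Num.Theory.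

Lemma bmul0l {K : numFieldType} {A : banachAlgType K} (a : A) : bmul 0 a = 0.
Proof. by have := bmulZl (0 : K) (0 : A) a; rewrite !scale0r. Qed.

Lemma open_set1_mdist {R : realType} {X : metricType R} (x : X) :
  open [set x] ->
  exists2 e : R, 0 < e & forall y, x != y -> e <= mdist x y.
Proof.
rewrite openE => /(_ x erefl) /nbhs_ballP[e /= e0 xe]; exists e => // y.
apply: contra_neqT; rewrite -ltNge => xy.
by apply/esym/xe; rewrite ballEmdist.
Qed.

Section point_mass.
Context {R : realType} {X : metricType R} {A : banachAlgType R[i]} {x : X}.

(** The function with value [a] at [x] and [0] elsewhere; for general [x] it need
    not be Lipschitz. *)
Definition point_mass_fun (a : A) (y : X) : A := if y == x then a else 0.

Lemma rnorm_point_mass_fun a y : rnorm (point_mass_fun a y) <= rnorm a.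
Proof. by rewrite /point_mass_fun; case: ifP; rewrite // rnorm0 rnorm_ge0. Qed.

Lemma point_mass_fun_lipschitz (e : R) a : 0 < e ->
  (forall y, x != y -> e <= mdist x y) ->
  forall y z, rnorm (point_mass_fun a y - point_mass_fun a z) <=
    e^-1 * rnorm a * mdist y z.
Proof.
move=> e0 xe y z.
have bound w : x != w -> rnorm a <= e^-1 * rnorm a * mdist x w.
  by move=> /xe ew; rewrite mulrAC ler_peMl ?rnorm_ge0// ler_pdivlMl// mulr1.
rewrite /point_mass_fun; have [->|yx] := eqVneq y x.
  have [->|zx] := eqVneq z x; first by rewrite subrr rnorm0 mdistxx mulr0.
  by rewrite subr0 bound// eq_sym.
have [->|zx] := eqVneq z x.
  by rewrite sub0r rnormN metric_sym bound// eq_sym.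
by rewrite subrr rnorm0 !mulr_ge0 ?mdist_ge0 ?rnorm_ge0// invr_ge0 ltW.
Qed.

Context (xo : open [set x]).

Lemma is_lip_point_mass a : is_lip (point_mass_fun a).
Proof.
have [e e0 xe] := open_set1_mdist _ xo; apply/is_lipP.
exists (rnorm a + e^-1 * rnorm a) => [y|y z].
  rewrite (le_trans (rnorm_point_mass_fun a y))// lerDl.
  by rewrite mulr_ge0 ?rnorm_ge0// invr_ge0 ltW.
rewrite (le_trans (point_mass_fun_lipschitz _ a e0 xe y z))//.
by rewrite ler_wpM2r ?mdist_ge0// lerDr rnorm_ge0.
Qed.

(** [point_mass_fun a] as an element of [Lip X A], [x] being isolated. *)
Definition point_mass (a : A) : Lip X A :=
  MkLip (introT (asboolP _) (is_lip_point_mass a)).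

Fact point_mass_is_linear : linear point_mass.
Proof.
move=> k a b; apply: Lip_ext => y; rewrite /= !fctE /= /point_mass_fun.
by case: eqP => // _; rewrite scaler0 addr0.
Qed.

HB.instance Definition _ := GRing.isLinear.Build R[i] A (Lip X A) *:%R
  point_mass point_mass_is_linear.

Lemma point_massE a : point_mass a x = a.
Proof. by rewrite /= /point_mass_fun eqxx. Qed.

Lemma bmul_point_mass a (f : Lip X A) :
  bmul (point_mass a) f = point_mass (bmul a (f x)).
Proof.
apply: Lip_ext => y; rewrite /= /point_mass_fun.
by case: eqP => [->//|_]; rewrite bmul0l.
Qed.

Lemma lip_norm_point_mass :
  exists2 C : R, 0 <= C & forall a, lip_norm (point_mass a) <= C * rnorm a.
Proof.
have [e e0 xe] := open_set1_mdist _ xo; exists (1 + e^-1) => [|a].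
  by rewrite addr_ge0// invr_ge0 ltW.
rewrite mulrDl mul1r lerD//.
  by apply: sup_norm_le; [exact: rnorm_ge0|exact: rnorm_point_mass_fun].
apply: lip_seminorm_le; last exact: point_mass_fun_lipschitz.
by rewrite mulr_ge0 ?rnorm_ge0// invr_ge0 ltW.
Qed.

Lemma point_mass_continuous : continuous point_mass.
Proof.
have [C C0 aC] := lip_norm_point_mass.
apply/linear_bounded_continuous/ex_bound; exists C%:C%C.
apply/nbhs_norm0P; exists 1 => [/=|a /= /ltW]; first exact: ltr01.
(* Both norms take their values in [R[i]]: the estimate is moved to [R]. *)
rewrite -[X in _ -> X <= _]/((lip_norm (point_mass a))%:C%C) rnormE.
rewrite -[1]/(1%:C%C) !lecR => a1.
by rewrite (le_trans (aC a))// ler_piMr.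
Qed.

End point_mass.

Theorem proposition3p4 (R : realType) (X : metricType R)
    (A : banachAlgType R[i]) :
  (forall x : X, open [set x]) ->
  point_amenable A ->
  forall (x : X) (phi : character A) (D : {scalar (Lip X A)}),
    continuous_point_derivation (eval_character x phi) D ->
    forall f : Lip X A, D f = 0.
Proof.
move=> Xo Aam x phi D [Dc DM] f.
have D0 a : D (point_mass (Xo x) a) = 0.
  apply: (Aam phi (D \o point_mass (Xo x)))%FUN; split=> [b|b c] /=.
    apply: continuous_comp; [exact: point_mass_continuous|exact: Dc].
  (* [point_mass] is multiplicative, so the Leibniz rule of [D] applies. *)
  have -> : point_mass (Xo x) (bmul b c) =
      bmul (point_mass (Xo x) b) (point_mass (Xo x) c).
    by rewrite bmul_point_mass point_massE.
  by rewrite DM /= /eval_fun !point_massE.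
have [a phia] := character_neq0 phi.
have := DM (point_mass (Xo x) a) f.
rewrite bmul_point_mass !D0 mulr0 addr0 /= /eval_fun point_massE => /esym/eqP.
by rewrite mulf_eq0 (negPf phia) => /eqP.
Qed.
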